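(* Let $U$ be a model of $\mathrm{ZFCU}_{\mathrm{R}}$. The following are equivalent: (1) the Łoś theorem holds for all internal ultrapowers of $U$; (2) $U\models$ Collection.
   Context: The language of urelement set theory has $\in$ and a unary predicate $\mathcal{A}$ for urelements. $\mathrm{ZFCU}_{\mathrm{R}}$ = ZU (urelements have no members, Extensionality for sets, Foundation, Pairing, Union, Powerset, Infinity, Separation scheme) + Replacement scheme + AC. Collection: for every formula $\varphi$, $\forall w,u(\forall x\in w\,\exists y\,\varphi(x,y,u)\to\exists v\,\forall x\in w\,\exists y\in v\,\varphi(x,y,u))$. Internal ultrapower: given $F,x\in U$ with $U\models$ ''$F$ is an ultrafilter on $x$'', for $f,g\in U$ that $U$ thinks are functions on $x$ put $f=_Fg$ iff $U\models\{y\in x:f(y)=g(y)\}\in F$; $[f]$ is the $=_F$-class of $f$, $U/F$ the set of all such classes, $[g]\hat\in[f]$ iff $U\models\{y\in x:g(y)\in f(y)\}\in F$, and $\hat{\mathcal{A}}([f])$ iff $U\models\{y\in x:\mathcal{A}(f(y))\}\in F$. The Łoś theorem holds for $U/F$ if for every formula $\varphi$ and $[f_1],\dots,[f_n]$, $U/F\models\varphi([f_1],\dots,[f_n])$ iff $U\models\{y\in x:\varphi(f_1(y),\dots,f_n(y))\}\in F$. *)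

(* Defs.v *)
(* First-order language with equality of urelement set theory, de Bruijn
   indices: [Ex phi] binds index 0 of [phi]. Semantics is classical, so the
   remaining connectives are definable. *)
Inductive formula : Type :=
| Eq  (i j : nat)
| Mem (i j : nat)
| Ur  (i : nat)
| Neg (phi : formula)
| And (phi psi : formula)
| Ex  (phi : formula).

Record structure : Type := Structure {
  carrier :> Type;
  mem : carrier -> carrier -> Prop;
  ur : carrier -> Prop
}.

Arguments mem {s} _ _.
Arguments ur {s} _.

Definition scons {T : Type} (a : T) (e : nat -> T) (n : nat) : T :=
  match n with 0 => a | S m => e m end.

Fixpoint sat (U : structure) (e : nat -> U) (phi : formula) : Prop :=
  match phi with
  | Eq i j => e i = e j
  | Mem i j => mem (e i) (e j)
  | Ur i => ur (e i)
  | Neg psi => ~ sat U e psi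
  | And psi chi => sat U e psi /\ sat U e chi
  | Ex psi => exists a : U, sat U (scons a e) psi
  end.

(* Satisfaction of the theories below is written out. In the schemes, the tail
   [e] of the assignment carries an arbitrary finite list of parameters. *)
Section Models.
Variable U : structure.
Implicit Types a b c f p s t u v w x y z : U.

Definition is_set x : Prop := ~ ur x.
Definition subset x y : Prop := forall z, mem z x -> mem z y.
(* z = {a, b} *)
Definition is_upair z a b : Prop := forall t, mem t z <-> t = a \/ t = b.
(* Kuratowski pair: p = {{a}, {a, b}} *)
Definition is_opair p a b : Prop :=
  exists s t, is_upair s a a /\ is_upair t a b /\ is_upair p s t.
(* (a, b) is in f *)
Definition app f a b : Prop := exists p, mem p f /\ is_opair p a b.
Definition is_fun_on f x : Prop :=
  is_set f /\
  (forall p, mem p f -> exists a b, mem a x /\ is_opair p a b) /\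
  (forall a, mem a x -> exists! b, app f a b).

Definition ax_urelements : Prop := forall x y, ur x -> ~ mem y x.
Definition ax_extensionality : Prop :=
  forall x y, is_set x -> is_set y ->
    (forall z, mem z x <-> mem z y) -> x = y.
Definition ax_foundation : Prop :=
  forall x, (exists y, mem y x) ->
    exists y, mem y x /\ forall z, mem z y -> ~ mem z x.
Definition ax_pairing : Prop := forall a b, exists z, is_upair z a b.
Definition ax_union : Prop :=
  forall x, exists v, is_set v /\
    forall z, mem z v <-> exists y, mem y x /\ mem z y.
Definition ax_powerset : Prop :=
  forall x, exists v, is_set v /\
    forall z, mem z v <-> is_set z /\ subset z x.
Definition ax_infinity : Prop :=
  exists w,
    (exists z, mem z w /\ is_set z /\ forall t, ~ mem t z) /\
    (forall y, mem y w ->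
       exists z, mem z w /\ forall t, mem t z <-> mem t y \/ t = y).
Definition ax_separation : Prop :=
  forall (phi : formula) (e : nat -> U) w, exists v, is_set v /\
    forall y, mem y v <-> mem y w /\ sat U (scons y e) phi.
Definition ax_replacement : Prop :=
  forall (phi : formula) (e : nat -> U) w,
    (forall x, mem x w -> exists! y, sat U (scons x (scons y e)) phi) ->
    exists v, forall x, mem x w ->
      exists y, mem y v /\ sat U (scons x (scons y e)) phi.
Definition ax_choice : Prop :=
  forall w, (forall y, mem y w -> exists z, mem z y) ->
    exists f, is_fun_on f w /\
      forall y z, mem y w -> app f y z -> mem z y.

Record ZU : Prop := {
  ZU_urelements : ax_urelements;
  ZU_extensionality : ax_extensionality;
  ZU_foundation : ax_foundation;
  ZU_pairing : ax_pairing;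
  ZU_union : ax_union;
  ZU_powerset : ax_powerset;
  ZU_infinity : ax_infinity;
  ZU_separation : ax_separation
}.

Record ZFCU_R : Prop := {
  ZFCU_R_ZU : ZU;
  ZFCU_R_replacement : ax_replacement;
  ZFCU_R_choice : ax_choice
}.

Definition Collection : Prop :=
  forall (phi : formula) (e : nat -> U) w,
    (forall x, mem x w -> exists y, sat U (scons x (scons y e)) phi) ->
    exists v, forall x, mem x w ->
      exists y, mem y v /\ sat U (scons x (scons y e)) phi.

(* U |= "F is an ultrafilter on x" *)
Record is_ultrafilter_on (F x : U) : Prop := {
  uf_set_base : is_set x;
  uf_set : is_set F;
  uf_subsets : forall s, mem s F -> is_set s /\ subset s x;
  uf_full : mem x F;
  uf_nonempty : forall s, mem s F -> exists y, mem y s;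
  uf_up : forall s t, mem s F -> is_set t -> subset s t -> subset t x ->
    mem t F;
  uf_inter : forall s t u, mem s F -> mem t F -> is_set u ->
    (forall y, mem y u <-> mem y s /\ mem y t) -> mem u F;
  uf_ultra : forall s t, is_set s -> subset s x -> is_set t ->
    (forall y, mem y t <-> mem y x /\ ~ mem y s) -> mem s F \/ mem t F
}.

(* U |= {y in x : P y} in F *)
Definition large (F x : U) (P : U -> Prop) : Prop :=
  exists s, is_set s /\ (forall y, mem y s <-> mem y x /\ P y) /\ mem s F.

(* f =_F g *)
Definition eqF (F x f g : U) : Prop :=
  large F x (fun y => exists a, app f y a /\ app g y a).

(* [f], as the predicate defining the =_F-class of f *)
Definition eqF_class (F x f : U) : U -> Prop :=
  fun g => is_fun_on g x /\ eqF F x f g.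

Definition ultrapower_carrier (F x : U) : Type :=
  { c : U -> Prop | exists f, is_fun_on f x /\ c = eqF_class F x f }.

Definition cls (F x f : U) (hf : is_fun_on f x) : ultrapower_carrier F x :=
  exist _ (eqF_class F x f) (ex_intro _ f (conj hf eq_refl)).

Definition ultrapower (F x : U) : structure :=
  {| carrier := ultrapower_carrier F x;
     mem := fun c d : ultrapower_carrier F x =>
       exists g f (hg : is_fun_on g x) (hf : is_fun_on f x),
       c = cls F x g hg /\ d = cls F x f hf /\
       large F x (fun y => exists a b, app g y a /\ app f y b /\ mem a b);
     ur := fun c : ultrapower_carrier F x =>
       exists f (hf : is_fun_on f x),
       c = cls F x f hf /\
       large F x (fun y => exists a, app f y a /\ ur a) |}.

(* The representatives are given for all indices at once; only those of the
   finitely many free variables of [phi] matter. *)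
Definition Los_theorem_holds (F x : U) : Prop :=
  forall (phi : formula) (f : nat -> U) (hf : forall n, is_fun_on (f n) x),
    sat (ultrapower F x) (fun n => cls F x (f n) (hf n)) phi <->
    large F x (fun y =>
      exists e : nat -> U, (forall n, app (f n) y (e n)) /\ sat U e phi).

Definition Los_holds_for_all_internal_ultrapowers : Prop :=
  forall F x, is_ultrafilter_on F x -> Los_theorem_holds F x.

End Models.

(* Main.v *)
Require Import Defs.
From Stdlib Require Import Classical ClassicalEpsilon FunctionalExtensionality
  PropExtensionality Arith Lia.

(** Collection gives the existential step of the Łoś theorem: it bounds the
    witnesses on a large set by a set [v], and a choice function on the subsets
    of [v] turns them into a function.

    Conversely, suppose that Collection fails for [phi] on [w].  The subsets of
    [w] on which it holds form a proper ideal, so some ultrafilter [F] on [w]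
    avoids it.  The Łoś theorem for [Ex phi] at the class of the identity yields
    a [g] with [phi (y, g y)] for all [y] in some [s] of [F]; the range of [g]
    then collects witnesses on [s], a contradiction.

    The ultrafilter has to be an element of [U], so the prime ideal theorem is
    proved inside [U], from AC. *)

(** * Definability with parameters, and its closure properties *)

Section Definability.
Variable U : structure.

Fixpoint rename (r : nat -> nat) (phi : formula) : formula :=
  match phi with
  | Eq i j => Eq (r i) (r j)
  | Mem i j => Mem (r i) (r j)
  | Ur i => Ur (r i)
  | Neg psi => Neg (rename r psi)
  | And psi chi => And (rename r psi) (rename r chi)
  | Ex psi => Ex (rename (scons 0 (fun n => S (r n))) psi)
  end.

Lemma sat_rename (phi : formula) (r : nat -> nat) (e : nat -> U) :
  sat U e (rename r phi) <-> sat U (fun n => e (r n)) phi.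
Proof.
  revert r e; induction phi as [| | |phi IH|phi IH psi IH'|phi IH];
    intros r e; cbn; try tauto.
  - now rewrite IH.
  - now rewrite IH, IH'.
  - assert (H : forall a, (fun n => scons a e (scons 0 (fun n => S (r n)) n))
                    = scons a (fun n => e (r n))).
    { intros a; apply functional_extensionality; now intros [|n]. }
    split; intros [a Ha]; exists a.
    + rewrite IH, H in Ha; exact Ha.
    + rewrite IH, H; exact Ha.
Qed.

(* A variable of a formula is read either off the assignment or as a fixed
   parameter from [U]. *)
Definition lookup (s : nat -> nat + U) (e : nat -> U) (n : nat) : U :=
  match s n with inl k => e k | inr c => c end.

(** Semantic, so that instances of the axiom schemes can be stated with Rocq predicates and no de
    Bruijn formula has to be written out. *)
Definition definable (P : (nat -> U) -> Prop) : Prop :=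
  exists phi s, forall e, sat U (lookup s e) phi <-> P e.

(** Definability of the graph: index 0 holds the value, and the arguments are shifted by one. *)
Definition definable_term (t : (nat -> U) -> U) : Prop :=
  definable (fun e => e 0 = t (fun n => e (S n))).

Lemma definable_iff (P Q : (nat -> U) -> Prop) :
  definable P -> (forall e, P e <-> Q e) -> definable Q.
Proof.
  intros (phi & s & H) HPQ; exists phi, s; intros e; now rewrite H.
Qed.

Lemma definable_weaken (g : nat -> nat) (P : (nat -> U) -> Prop) :
  definable P -> definable (fun e => P (fun n => e (g n))).
Proof.
  intros (phi & s & H).
  exists phi, (fun n => match s n with inl k => inl (g k) | inr c => inr c end).
  intros e; rewrite <- H.
  replace (lookup s (fun n => e (g n))) with
    (lookup (fun n => match s n with inl k => inl (g k) | inr c => inr c end) e);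
    [tauto|].
  apply functional_extensionality; intros n; unfold lookup; now destruct (s n).
Qed.

Lemma definable_neg (P : (nat -> U) -> Prop) :
  definable P -> definable (fun e => ~ P e).
Proof.
  intros (phi & s & H); exists (Neg phi), s; intros e; cbn; now rewrite H.
Qed.

(** The two formulas come with different lookup maps. Moving one to the even and the other to the
    odd variables lets a single map serve both. *)
Lemma definable_and (P Q : (nat -> U) -> Prop) :
  definable P -> definable Q -> definable (fun e => P e /\ Q e).
Proof.
  intros (phi & s & H) (psi & t & K).
  exists (And (rename (fun n => n + n) phi) (rename (fun n => S (n + n)) psi)).
  exists (fun n => if Nat.even n then s (Nat.div2 n) else t (Nat.div2 n)).
  intros e; cbn; rewrite !sat_rename, <- H, <- K.
  match goal with |- sat U ?a phi /\ sat U ?b psi <-> _ =>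
    replace a with (lookup s e); [replace b with (lookup t e); [tauto|]|] end;
  apply functional_extensionality; intros n; unfold lookup.
  - replace (S (n + n)) with (S (2 * n)) by lia.
    rewrite Nat.div2_succ_double, Nat.even_succ, Nat.odd_mul; reflexivity.
  - replace (n + n) with (2 * n) by lia.
    rewrite Nat.div2_double, Nat.even_mul; reflexivity.
Qed.

(** Several variables of [phi] may be read off index 0. All of them are identified with the bound
    variable, and the others are shifted past it. *)
Lemma definable_ex (Q : U -> (nat -> U) -> Prop) :
  definable (fun e => Q (e 0) (fun n => e (S n))) ->
  definable (fun e => exists a, Q a e).
Proof.
  intros (phi & s & H).
  exists (Ex (rename (fun n => match s n with inl 0 => 0 | _ => S n end) phi)).
  exists (fun n => match s n with
                   | inl 0 => inl 0 | inl (S k) => inl k | inr c => inr c end).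
  intros e; cbn.
  match goal with |- (exists a, @?A a) <-> _ =>
    enough (E : forall a, A a <-> Q a e) end.
  { split; intros [a Ha]; exists a; now apply E. }
  intros a; cbv beta; rewrite sat_rename.
  rewrite <- (H (scons a e)).
  match goal with |- sat U ?x _ <-> sat U ?y _ => replace x with y; [tauto|] end.
  apply functional_extensionality; intros n; unfold lookup.
  destruct (s n) as [[|k]|c] eqn:E; cbn; rewrite ?E; reflexivity.
Qed.

Lemma definable_or (P Q : (nat -> U) -> Prop) :
  definable P -> definable Q -> definable (fun e => P e \/ Q e).
Proof.
  intros HP HQ.
  apply definable_iff with (fun e => ~ (~ P e /\ ~ Q e)).
  - apply definable_neg, definable_and; now apply definable_neg.
  - intros e; tauto.
Qed.

Lemma definable_imp (P Q : (nat -> U) -> Prop) :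
  definable P -> definable Q -> definable (fun e => P e -> Q e).
Proof.
  intros HP HQ.
  apply definable_iff with (fun e => ~ P e \/ Q e).
  - apply definable_or; [now apply definable_neg|assumption].
  - intros e; tauto.
Qed.

Lemma definable_equiv (P Q : (nat -> U) -> Prop) :
  definable P -> definable Q -> definable (fun e => P e <-> Q e).
Proof.
  intros HP HQ; apply definable_and; now apply definable_imp.
Qed.

Lemma definable_all (Q : U -> (nat -> U) -> Prop) :
  definable (fun e => Q (e 0) (fun n => e (S n))) ->
  definable (fun e => forall a, Q a e).
Proof.
  intros HQ.
  apply definable_iff with (fun e => ~ exists a, ~ Q a e).
  - apply definable_neg, definable_ex, definable_neg, HQ.
  - intros e; split; [intros H a; apply NNPP; eauto|intros H [a Ha]; auto].
Qed.

Lemma definable_eq_var (i j : nat) : definable (fun e => e i = e j).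
Proof. exists (Eq i j), inl; cbn; reflexivity. Qed.

Lemma definable_mem_var (i j : nat) : definable (fun e => mem (e i) (e j)).
Proof. exists (Mem i j), inl; cbn; reflexivity. Qed.

Lemma definable_ur_var (i : nat) : definable (fun e => ur (e i)).
Proof. exists (Ur i), inl; cbn; reflexivity. Qed.

Lemma definable_term_var (n : nat) : definable_term (fun e => e n).
Proof. exact (definable_eq_var 0 (S n)). Qed.

Lemma definable_term_const (c : U) : definable_term (fun _ => c).
Proof.
  exists (Eq 0 1), (fun n => match n with 0 => inl 0 | _ => inr c end).
  intros e; cbn; reflexivity.
Qed.

Lemma definable_term_lift (t : (nat -> U) -> U) :
  definable_term t -> definable_term (fun e => t (fun n => e (S n))).
Proof.
  intros H.
  exact (definable_weaken (fun n => match n with 0 => 0 | S m => S (S m) end) _ H).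
Qed.

(** Substitution is expressed by quantifying over the value: some [a] equals [t e] and satisfies
    [Q]. *)
Lemma definable_subst (Q : U -> (nat -> U) -> Prop) (t : (nat -> U) -> U) :
  definable (fun e => Q (e 0) (fun n => e (S n))) -> definable_term t ->
  definable (fun e => Q (t e) e).
Proof.
  intros HQ Ht.
  apply definable_iff with (fun e => exists a, a = t e /\ Q a e).
  - exact (definable_ex (fun a e => a = t e /\ Q a e) (definable_and _ _ Ht HQ)).
  - intros e; split; [now intros (a & -> & Ha)|eauto].
Qed.

Lemma definable_app1 (R : U -> Prop) (t : (nat -> U) -> U) :
  definable (fun e => R (e 0)) -> definable_term t ->
  definable (fun e => R (t e)).
Proof. exact (definable_subst (fun a _ => R a) t). Qed.

Lemma definable_app2 (R : U -> U -> Prop) (t u : (nat -> U) -> U) :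
  definable (fun e => R (e 0) (e 1)) -> definable_term t -> definable_term u ->
  definable (fun e => R (t e) (u e)).
Proof.
  intros HR Ht Hu.
  apply (definable_subst (fun a e => R a (u e)) t); [|assumption].
  apply (definable_subst (fun b e => R (e 0) b) (fun e => u (fun n => e (S n))));
    [|now apply definable_term_lift].
  exact (definable_weaken
           (fun n => match n with 0 => 1 | _ => 0 end) _ HR).
Qed.

Definition definable_eq t u : definable_term t -> definable_term u ->
    definable (fun e => t e = u e) :=
  definable_app2 eq t u (definable_eq_var 0 1).
Definition definable_mem t u : definable_term t -> definable_term u ->
    definable (fun e => mem (t e) (u e)) :=
  definable_app2 mem t u (definable_mem_var 0 1).
Definition definable_ur t : definable_term t -> definable (fun e => ur (t e)) :=
  definable_app1 ur t (definable_ur_var 0).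

End Definability.

Arguments definable {U} _.
Arguments definable_term {U} _.

Ltac define_term :=
  first [ assumption | apply definable_term_var | apply definable_term_const
        | apply definable_term_lift; define_term ].

(** Splits a definability goal along its outermost connective; the last two cases appeal to a
    hypothesis about an abstract predicate. The [forall] pattern matches implications too, hence its
    two alternatives. *)
Ltac define_step :=
  cbv beta;
  lazymatch goal with
  | |- definable (fun e => exists a, _) => apply definable_ex
  | |- definable (fun e => _ /\ _) => apply definable_and
  | |- definable (fun e => _ \/ _) => apply definable_or
  | |- definable (fun e => _ <-> _) => apply definable_equiv
  | |- definable (fun e => ~ _) => apply definable_neg
  | |- definable (fun e => _ = _) => apply definable_eq; define_term
  | |- definable (fun e => mem _ _) => apply definable_mem; define_term
  | |- definable (fun e => ur _) => apply definable_ur; define_term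
  | |- definable (fun e => forall a, _) =>
      first [apply definable_all | apply definable_imp]
  | H : definable (fun e => ?R (e 0) (e 1)) |- definable (fun e => ?R _ _) =>
      apply (definable_app2 _ R); [exact H|define_term|define_term]
  | H : definable (fun e => ?R (e 0)) |- definable (fun e => ?R _) =>
      apply (definable_app1 _ R); [exact H|define_term]
  end.

Ltac define :=
  unfold unique, app, is_fun_on, is_opair, is_upair, subset, is_set;
  repeat define_step.

(** * The axiom schemes for definable predicates *)

Section Sets.
Variable U : structure.
Hypothesis hU : ZFCU_R U.

Lemma separation (P : U -> Prop) (w : U) :
  definable (fun e => P (e 0)) ->
  exists v, is_set U v /\ forall y, mem y v <-> mem y w /\ P y.
Proof.
  intros (phi & s & H).
  (* Variables that read index 0 become the separated variable. All others are frozen as parameters,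
     with [w] as an arbitrary filler for the remaining indices, on which [P] does not depend. *)
  destruct (ZU_separation _ (ZFCU_R_ZU _ hU)
    (rename (fun n => match s n with inl 0 => 0 | _ => S n end) phi)
    (lookup U s (fun _ => w)) w) as (v & Hv & Hvw).
  exists v; split; [assumption|]; intros y; rewrite Hvw, sat_rename.
  rewrite <- (H (scons y (fun _ => w))).
  match goal with |- _ /\ sat U ?a _ <-> _ /\ sat U ?b _ =>
    replace a with b; [tauto|] end.
  apply functional_extensionality; intros n; unfold lookup.
  destruct (s n) as [[|k]|c] eqn:E; cbn; rewrite ?E; reflexivity.
Qed.

Lemma formula_of_definable2 (R : U -> U -> Prop) (d : U) :
  definable (fun e => R (e 0) (e 1)) ->
  exists phi e, forall x y, sat U (scons x (scons y e)) phi <-> R x y.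
Proof.
  intros (phi & s & H).
  exists (rename (fun n => match s n with
                 inl 0 => 0 | inl 1 => 1 | _ => S (S n) end) phi).
  exists (lookup U s (fun _ => d)).
  intros x y; rewrite sat_rename.
  rewrite <- (H (scons x (scons y (fun _ => d)))).
  match goal with |- sat U ?a _ <-> sat U ?b _ => replace a with b; [tauto|] end.
  apply functional_extensionality; intros n; unfold lookup.
  destruct (s n) as [[|[|k]]|c] eqn:E; cbn; rewrite ?E; reflexivity.
Qed.

Lemma definable_sat2 (phi : formula) (e : nat -> U) :
  definable (fun e' => sat U (scons (e' 0) (scons (e' 1) e)) phi).
Proof.
  exists phi, (scons (inl 0) (scons (inl 1) (fun n => inr (e n)))).
  intros e'.
  match goal with |- sat U ?a _ <-> sat U ?b _ => replace a with b; [tauto|] end.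
  apply functional_extensionality; intros n; unfold lookup.
  now destruct n as [|[|n]].
Qed.

Lemma replacement (R : U -> U -> Prop) (w : U) :
  definable (fun e => R (e 0) (e 1)) ->
  (forall x, mem x w -> exists! y, R x y) ->
  exists v, forall x, mem x w -> exists y, mem y v /\ R x y.
Proof.
  intros HR H.
  destruct (formula_of_definable2 R w HR) as (phi & e & E).
  destruct (ZFCU_R_replacement _ hU phi e w) as [v Hv].
  - intros x Hx; destruct (H x Hx) as (y & Hy & Hu).
    exists y; split; [now apply E|]; intros z Hz; apply Hu; now apply E.
  - exists v; intros x Hx; destruct (Hv x Hx) as (y & Hy & Hs).
    exists y; split; [assumption|now apply E].
Qed.

Lemma collection (hC : Collection U) (R : U -> U -> Prop) (w : U) :
  definable (fun e => R (e 0) (e 1)) ->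
  (forall x, mem x w -> exists y, R x y) ->
  exists v, forall x, mem x w -> exists y, mem y v /\ R x y.
Proof.
  intros HR H.
  destruct (formula_of_definable2 R w HR) as (phi & e & E).
  destruct (hC phi e w) as [v Hv].
  - intros x Hx; destruct (H x Hx) as (y & Hy).
    exists y; now apply E.
  - exists v; intros x Hx; destruct (Hv x Hx) as (y & Hy & Hs).
    exists y; split; [assumption|now apply E].
Qed.

(** * Elementary set theory in [U]: pairs, unions, functions *)

Lemma set_of_mem (x y : U) : mem y x -> is_set U x.
Proof.
  intros H K; exact (ZU_urelements _ (ZFCU_R_ZU _ hU) x y K H).
Qed.

Lemma set_ext (x y : U) : is_set U x -> is_set U y ->
  (forall z, mem z x <-> mem z y) -> x = y.
Proof. apply (ZU_extensionality _ (ZFCU_R_ZU _ hU)). Qed.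

Lemma upair_set (z a b : U) : is_upair U z a b -> is_set U z.
Proof. intros H; apply set_of_mem with a; apply H; auto. Qed.

Lemma upair_fun (z z' a b : U) : is_upair U z a b -> is_upair U z' a b -> z = z'.
Proof.
  intros H H'; apply set_ext; try (now eapply upair_set; eauto).
  intros t; now rewrite (H t), (H' t).
Qed.

Lemma upair_inj (z a b c d : U) : is_upair U z a b -> is_upair U z c d ->
  (a = c /\ b = d) \/ (a = d /\ b = c).
Proof.
  intros H H'.
  assert (E : forall t, t = a \/ t = b <-> t = c \/ t = d).
  { intros t; now rewrite <- (H t), <- (H' t). }
  destruct (proj1 (E a) (or_introl eq_refl)), (proj1 (E b) (or_intror eq_refl)),
    (proj2 (E c) (or_introl eq_refl)), (proj2 (E d) (or_intror eq_refl));
    subst; auto.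
Qed.

Lemma opair_exists (a b : U) : exists p, is_opair U p a b.
Proof.
  pose proof (ZU_pairing _ (ZFCU_R_ZU _ hU)) as HP.
  destruct (HP a a) as [s Hs], (HP a b) as [t Ht], (HP s t) as [p Hp].
  exists p, s, t; auto.
Qed.

Lemma opair_fun (p q a b : U) : is_opair U p a b -> is_opair U q a b -> p = q.
Proof.
  intros (s & t & Hs & Ht & Hp) (s' & t' & Hs' & Ht' & Hp').
  pose proof (upair_fun _ _ _ _ Hs Hs'); pose proof (upair_fun _ _ _ _ Ht Ht').
  subst; eapply upair_fun; eauto.
Qed.

Lemma opair_inj (p a b c d : U) : is_opair U p a b -> is_opair U p c d ->
  a = c /\ b = d.
Proof.
  intros (s & t & Hs & Ht & Hp) (s' & t' & Hs' & Ht' & Hp').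
  destruct (upair_inj _ _ _ _ _ Hp Hp') as [[-> ->]|[-> ->]].
  - destruct (upair_inj _ _ _ _ _ Hs Hs') as [[? _]|[? _]];
    destruct (upair_inj _ _ _ _ _ Ht Ht') as [[? ?]|[? ?]]; subst; auto.
  - destruct (upair_inj _ _ _ _ _ Hs Ht') as [[? ?]|[? ?]];
    destruct (upair_inj _ _ _ _ _ Ht Hs') as [[? ?]|[? ?]]; subst; auto.
Qed.

Lemma powerset (x : U) : exists v, is_set U v /\
  forall z, mem z v <-> is_set U z /\ subset U z x.
Proof. apply (ZU_powerset _ (ZFCU_R_ZU _ hU)). Qed.

Lemma union_set (x : U) : exists v, is_set U v /\
  forall z, mem z v <-> exists y, mem y x /\ mem z y.
Proof. apply (ZU_union _ (ZFCU_R_ZU _ hU)). Qed.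

Lemma binary_union (a b : U) : exists v, is_set U v /\
  forall z, mem z v <-> mem z a \/ mem z b.
Proof.
  destruct (ZU_pairing _ (ZFCU_R_ZU _ hU) a b) as [p Hp].
  destruct (union_set p) as (v & Hv & Hvz).
  exists v; split; [assumption|]; intros z; rewrite Hvz; split.
  - intros (y & Hy & Hz); apply Hp in Hy as [->| ->]; auto.
  - intros [H|H]; [exists a|exists b]; split; auto; apply Hp; auto.
Qed.

(** Replacement for the map from [y] to the pair of [y] and its image gives a set containing the
    graph; Separation then cuts the graph out. *)
Lemma function_of_relation (R : U -> U -> Prop) (x : U) :
  definable (fun e => R (e 0) (e 1)) ->
  (forall y, mem y x -> exists! b, R y b) ->
  exists f, is_fun_on U f x /\
    forall y b, mem y x -> (app U f y b <-> R y b).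
Proof.
  intros HR H.
  destruct (replacement (fun y p => exists b, is_opair U p y b /\ R y b) x)
    as [v Hv].
  - define.
  - intros y Hy; destruct (H y Hy) as (b & Hb & Hu).
    destruct (opair_exists y b) as [p Hp].
    exists p; split; [eauto|]; intros q (c & Hq & Hc).
    rewrite (Hu c Hc) in Hp; eapply opair_fun; eauto.
  - destruct (separation
      (fun p => exists y b, mem y x /\ is_opair U p y b /\ R y b) v)
      as (f & Hf & Hfp); [define|].
    assert (Happ : forall y b, mem y x -> (app U f y b <-> R y b)).
    { intros y b Hy; split.
      - intros (p & Hp & Hpo); apply Hfp in Hp as (_ & y' & b' & _ & Hpo' & HR').
        destruct (opair_inj _ _ _ _ _ Hpo Hpo') as [-> ->]; assumption.
      - intros Hb; destruct (Hv y Hy) as (p & Hp & b' & Hpo & Hb').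
        destruct (H y Hy) as (c & _ & Hu).
        assert (b' = b) by (rewrite <- (Hu b Hb); symmetry; auto); subst b'.
        exists p; split; [apply Hfp; split; eauto 6|assumption]. }
    exists f; split; [split; [assumption|split]|assumption].
    + intros p Hp; apply Hfp in Hp as (_ & y & b & Hy & Hpo & _); eauto.
    + intros y Hy; destruct (H y Hy) as (b & Hb & Hu).
      exists b; split; [now apply Happ|].
      intros c Hc; apply Hu; now apply Happ.
Qed.

(** * Fixed points inside [U], without ordinals *)

Definition is_union (u C : U) : Prop :=
  is_set U u /\ forall z, mem z u <-> exists J, mem J C /\ mem z J.

(* Zermelo's tower: the least family closed under [step] and under unions is a
   chain, so its union is a fixed point that inherits every property preserved
   by [step] and by unions of chains. *)
Lemma internal_fixpoint (A : U) (step : U -> U -> Prop) (P : U -> Prop) :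
  definable (fun e => step (e 0) (e 1)) ->
  definable (fun e => P (e 0)) ->
  (forall J J' J'', step J J' -> step J J'' -> J' = J'') ->
  (forall J, is_set U J -> subset U J A -> exists J',
     step J J' /\ is_set U J' /\ subset U J' A /\ subset U J J') ->
  (forall J J', P J -> step J J' -> P J') ->
  (forall C u, (forall J, mem J C -> P J) ->
     (forall J K, mem J C -> mem K C -> subset U J K \/ subset U K J) ->
     is_union u C -> P u) ->
  exists M, P M /\ step M M.
Proof.
  intros dstep dP step_fun step_tot P_step P_union.
  destruct (powerset A) as (PA & _ & HPA).
  (* The union clause covers an empty [C], so every closed set contains the empty set and the tower
     needs no separate base. [T] below is the least closed set. *)
  set (closed K := (forall J J', mem J K -> step J J' -> mem J' K) /\
    (forall C u, (forall J, mem J C -> mem J K) -> is_union u C -> mem u K)).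
  destruct (separation (fun J => forall K, closed K -> mem J K) PA)
    as (T & HT & HTJ).
  { unfold closed, is_union; define. }
  assert (T_part : forall J, mem J T -> is_set U J /\ subset U J A).
  { intros J HJ; exact (proj1 (HPA J) (proj1 (proj1 (HTJ J) HJ))). }
  assert (T_next : forall J, mem J T -> exists J', step J J' /\ subset U J J').
  { intros J HJ; destruct (T_part J HJ) as [H1 H2].
    destruct (step_tot J H1 H2) as (J' & ? & _ & _ & ?); eauto. }
  assert (T_step : forall J J', mem J T -> step J J' -> mem J' T).
  { intros J J' HJ HS; apply HTJ; split.
    - destruct (T_part J HJ) as [H1 H2].
      destruct (step_tot J H1 H2) as (J'' & HS' & H3 & H4 & _).
      rewrite (step_fun _ _ _ HS HS'); now apply HPA.
    - intros K HK; apply (proj1 HK J); [|assumption].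
      exact (proj2 (proj1 (HTJ J) HJ) K HK). }
  assert (T_union : forall C u,
    (forall J, mem J C -> mem J T) -> is_union u C -> mem u T).
  { intros C u HC Hu; apply HTJ; split.
    - apply HPA; split; [apply Hu|].
      intros z Hz; apply Hu in Hz as (J & HJ & Hz).
      now apply (proj2 (T_part J (HC J HJ))).
    - intros K HK; apply (proj2 HK C); [|assumption].
      intros J HJ; exact (proj2 (proj1 (HTJ J) (HC J HJ)) K HK). }
  (* Induction along the tower: the members of [T] satisfying [Q] form a closed set, so they exhaust
     [T]. *)
  assert (T_ind : forall Q : U -> Prop, definable (fun e => Q (e 0)) ->
    (forall J J', mem J T -> Q J -> step J J' -> Q J') ->
    (forall C u, (forall J, mem J C -> mem J T /\ Q J) -> is_union u C -> Q u) ->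
    forall J, mem J T -> Q J).
  { intros Q dQ Q1 Q2 J HJ.
    destruct (separation Q T dQ) as (K & _ & HK).
    apply HK, (proj2 (proj1 (HTJ J) HJ) K); split.
    - intros L L' HL HS; apply HK in HL as [HL HQ].
      apply HK; eauto.
    - intros C u HC Hu; apply HK; split.
      + apply T_union with C; [|assumption]; intros L HL; now apply HK, HC.
      + apply Q2 with C; [|assumption]; intros L HL; now apply HK, HC. }
  (* Stepping from a member of [T] properly below a normal [x] stays within [x]. Normal sets turn
     out comparable with all of [T], and then all of [T] turns out normal. *)
  set (normal x := forall y, mem y T -> subset U y x -> y <> x ->
    forall y', step y y' -> subset U y' x).
  assert (antisym : forall x y, mem x T -> mem y T ->
    subset U x y -> subset U y x -> x = y).
  { intros x y Hx Hy Hxy Hyx; apply (set_ext x y).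
    - now apply T_part.
    - now apply T_part.
    - split; auto. }
  (* The second alternative asks for more than [subset U x y]: nothing in [T] lies strictly between
     [x] and its step. The induction needs this stronger form. *)
  assert (cmp : forall x, mem x T -> normal x -> forall y, mem y T ->
    subset U y x \/ forall x', step x x' -> subset U x' y).
  { intros x Hx Nx.
    apply (T_ind (fun y => subset U y x \/ forall x', step x x' -> subset U x' y)).
    - define.
    - intros y y' Hy [Hyx|Hxy] HS.
      + destruct (classic (y = x)) as [->|N]; [right|left; now apply (Nx y)].
        intros x' HS'; rewrite (step_fun _ _ _ HS HS'); intros z; auto.
      + right; intros x' HS' z Hz.
        destruct (T_next y Hy) as (y'' & HS'' & Hsub).
        rewrite (step_fun _ _ _ HS HS''); apply Hsub, (Hxy x'); assumption.
    - intros C u HC Hu.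
      destruct (classic (exists y, mem y C /\ forall x', step x x' -> subset U x' y))
        as [(y & Hy & Hxy)|N].
      + right; intros x' HS z Hz; apply Hu; exists y; split; [assumption|].
        now apply (Hxy x').
      + left; intros z Hz; apply Hu in Hz as (y & Hy & Hz).
        destruct (HC y Hy) as [_ [Hyx|Hxy]]; [auto|].
        destruct N; eauto. }
  assert (all_normal : forall x, mem x T -> normal x).
  { apply T_ind.
    - unfold normal; define.
    - intros z x Hz Nz HS y Hy Hyx N y' HS'.
      destruct (T_next z Hz) as (x' & HS'' & Hzx).
      rewrite <- (step_fun _ _ _ HS HS'') in Hzx.
      destruct (cmp z Hz Nz y Hy) as [Hyz|Hxy].
      + destruct (classic (y = z)) as [->|N'].
        * rewrite (step_fun _ _ _ HS' HS); intros t; auto.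
        * intros t Ht; apply Hzx, (Nz y Hy Hyz N' y' HS' t Ht).
      + destruct N; apply antisym; eauto.
    - intros C x HC Hx y Hy Hyx N y' HS.
      assert (HxT : mem x T).
      { apply T_union with C; [|assumption]; intros c Hc; now apply HC. }
      (* Otherwise [x], the union of [C], would be included in [y] and hence equal to it. *)
      assert (E : exists c, mem c C /\ ~ subset U c y).
      { apply NNPP; intros E; apply N, antisym; auto.
        intros z Hz; apply Hx in Hz as (c & Hc & Hz).
        apply NNPP; intros Hzy; apply E; exists c; split; auto. }
      destruct E as (c & Hc & Hcy), (HC c Hc) as [HcT Nc].
      assert (Hcx : subset U c x).
      { intros z Hz; apply Hx; eauto. }
      destruct (cmp c HcT Nc y Hy) as [Hyc|Hxy].
      + intros z Hz; apply Hcx, (Nc y Hy Hyc) with y'; auto.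
        intros ->; apply Hcy; intros t; auto.
      + destruct Hcy; intros z Hz.
        destruct (T_next c HcT) as (c' & HS' & Hcc).
        apply (Hxy c'); auto. }
  assert (chain : forall x y, mem x T -> mem y T ->
    subset U x y \/ subset U y x).
  { intros x y Hx Hy; destruct (cmp x Hx (all_normal x Hx) y Hy) as [H|H]; [auto|].
    left; intros z Hz; destruct (T_next x Hx) as (x' & HS & Hxx).
    apply (H x'); auto. }
  assert (allP : forall x, mem x T -> P x).
  { apply T_ind; [assumption|intros J J' _; apply P_step|].
    intros C u HC Hu; apply (P_union C); [intros J HJ; now apply HC| |assumption].
    intros J K HJ HK; apply chain; now apply HC. }
  (* The union of the whole tower belongs to the tower, and so does its step, which therefore cannot
     exceed it. *)
  destruct (union_set T) as [M HM].
  assert (HMT : mem M T) by (apply (T_union T); auto).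
  exists M; split; [auto|].
  destruct (T_next M HMT) as (M' & HS & HMM).
  replace M' with M in HS; [assumption|].
  apply antisym; eauto.
  intros z Hz; apply HM; exists M'; split; [|assumption]; eauto.
Qed.

(** * Ideals, choice functions and the prime ideal theorem inside [U] *)

Definition complement (w s t : U) : Prop :=
  is_set U t /\ forall y, mem y t <-> mem y w /\ ~ mem y s.

Record is_proper_ideal (w I : U) : Prop := {
  ideal_part : forall s, mem s I -> is_set U s /\ subset U s w;
  ideal_down : forall s t, mem s I -> is_set U t -> subset U t s -> mem t I;
  ideal_cup : forall s t u, mem s I -> mem t I -> is_set U u ->
    (forall y, mem y u -> mem y s \/ mem y t) -> mem u I;
  ideal_proper : ~ mem w I
}.

Lemma definable_is_proper_ideal (w : U) :
  definable (fun e => is_proper_ideal w (e 0)).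
Proof.
  apply definable_iff with (fun e =>
   (forall s, mem s (e 0) -> is_set U s /\ subset U s w) /\
   (forall s t, mem s (e 0) -> is_set U t -> subset U t s -> mem t (e 0)) /\
   (forall s t u, mem s (e 0) -> mem t (e 0) -> is_set U u ->
    (forall y, mem y u -> mem y s \/ mem y t) -> mem u (e 0)) /\
   ~ mem w (e 0)).
  - define.
  - intros e; split; [intros (? & ? & ? & ?); now split|].
    intros []; auto.
Qed.

Lemma app_fun (f x y a b : U) : is_fun_on U f x ->
  app U f y a -> app U f y b -> a = b.
Proof.
  intros (_ & Hd & Hf) Ha Hb.
  assert (Hy : mem y x).
  { destruct Ha as (p & Hp & Ho); destruct (Hd p Hp) as (y' & b' & Hy' & Ho').
    now destruct (opair_inj _ _ _ _ _ Ho Ho') as [-> _]. }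
  destruct (Hf y Hy) as (c & _ & Hu).
  now rewrite <- (Hu a Ha), <- (Hu b Hb).
Qed.

Lemma app_dom (f x y a : U) : is_fun_on U f x -> app U f y a -> mem y x.
Proof.
  intros (_ & Hd & _) (p & Hp & Ho).
  destruct (Hd p Hp) as (y' & b' & Hy' & Ho').
  now destruct (opair_inj _ _ _ _ _ Ho Ho') as [-> _].
Qed.

(** AC applied to the set of nonempty subsets of [v]. *)
Lemma choice_on_subsets (v : U) : exists c,
  (forall B a b, app U c B a -> app U c B b -> a = b) /\
  (forall B a, app U c B a -> mem a B) /\
  (forall B, is_set U B -> subset U B v -> (exists z, mem z B) ->
     exists a, app U c B a).
Proof.
  destruct (powerset v) as (PV & _ & HPV).
  destruct (separation (fun B => exists z, mem z B) PV) as (W & _ & HW); [define|].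
  destruct (ZFCU_R_choice _ hU W) as (c & Hc & Hch).
  { intros B HB; now apply HW. }
  exists c; split; [|split].
  - intros B a b; now apply app_fun with W.
  - intros B a Ha; apply Hch; [eapply app_dom; eauto|assumption].
  - intros B HB HBv HBz; destruct Hc as (_ & _ & Hc).
    destruct (Hc B) as (a & Ha & _); [|eauto].
    apply HW; split; [now apply HPV|assumption].
Qed.

(** Each step adjoins to the ideal one undecided subset of [w], picked by a choice function. A fixed
    point gains nothing, so it leaves no subset undecided. *)
Lemma prime_ideal (w I : U) : is_set U w -> is_proper_ideal w I ->
  (exists s, mem s I) ->
  exists M, is_proper_ideal w M /\ subset U I M /\
    forall s t, is_set U s -> subset U s w -> complement w s t ->
      mem s M \/ mem t M.
Proof.
  intros Hw HI [s0 Hs0].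
  destruct (powerset w) as (PW & HPWs & HPW).
  destruct (choice_on_subsets PW) as (c & c_fun & c_mem & c_tot).
  set (undecided J r := is_set U r /\ subset U r w /\ ~ mem r J /\
    forall r', complement w r r' -> ~ mem r' J).
  (* [B] is the set of all undecided sets; the fixed choice function [c] picks from it, so the
     selection is definable and unique. *)
  set (chosen J s := exists B, is_set U B /\
    (forall r, mem r B <-> undecided J r) /\ app U c B s).
  (* For an ideal [J], this is the ideal generated by [J] and [s]. *)
  set (adjoined J s t := is_set U t /\ subset U t w /\
    exists j, mem j J /\ forall y, mem y t -> mem y j \/ mem y s).
  (* The disjunct [mem t I] starts the tower: the empty set steps to [I]. *)
  set (next J t := mem t I \/ mem t J \/
    exists s, chosen J s /\ adjoined J s t).
  set (step J J' := is_set U J' /\ forall t, mem t J' <-> next J t).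
  assert (chosen_fun : forall J s t, chosen J s -> chosen J t -> s = t).
  { intros J s t (B & HB & HBr & Hs) (B' & HB' & HBr' & Ht).
    replace B' with B in Ht; [eapply c_fun; eauto|].
    apply (set_ext B B'); auto; intros z; now rewrite HBr, HBr'. }
  assert (chosen_undecided : forall J s, chosen J s -> undecided J s).
  { intros J s (B & _ & HBr & Hs); now apply HBr, c_mem. }
  assert (next_part : forall J t, subset U J PW -> next J t -> mem t PW).
  { intros J t HJ [H|[H|(s & _ & H1 & H2 & _)]]; auto.
    - apply HPW; now apply (ideal_part w I HI).
    - now apply HPW. }
  (* The empty set is a stage of the tower but does not include the nonempty [I]; the first disjunct
     of the invariant accounts for it. *)
  destruct (internal_fixpoint PW step
    (fun J => (forall z, ~ mem z J) \/ (is_proper_ideal w J /\ subset U I J)))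
    as (M & PM & HM & HMn).
  - unfold step, next, chosen, adjoined, undecided, complement; define.
  - apply definable_or; [define|apply definable_and; [|define]].
    apply definable_is_proper_ideal.
  - intros J J' J'' [H1 H2] [H3 H4].
    apply set_ext; auto; intros z; now rewrite H2, H4.
  - intros J HJ HJP.
    destruct (separation (next J) PW) as (J' & HJ' & HJn).
    { unfold next, chosen, adjoined, undecided, complement; define. }
    assert (E : forall t, mem t J' <-> next J t).
    { intros t; rewrite HJn; split; [tauto|]; intros H; split; eauto. }
    exists J'; split; [split; assumption|split; [assumption|split]].
    + intros t Ht; now apply HJn.
    + intros t Ht; apply E; right; auto.
  - intros J J' [HJ|[HJ HIJ]] [HJ' HJn].
    + assert (J' = I) as ->.
      { apply set_ext; [assumption|now apply (set_of_mem I s0)|].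
        intros z; rewrite HJn; unfold next, adjoined; split; [|tauto].
        intros [H|[H|(s & _ & _ & _ & j & H & _)]]; [assumption| |];
        now destruct (HJ _ H). }
      right; split; [assumption|intros z; auto].
    + right; split; [|intros z Hz; apply HJn; left; auto].
      destruct (classic (exists s, chosen J s)) as [[s Hs]|N].
      * assert (E : forall t, mem t J' <-> adjoined J s t).
        { intros t; rewrite HJn; unfold next; split.
          - assert (HJa : mem t J -> adjoined J s t).
            { intros H; destruct (ideal_part _ _ HJ t H).
              split; [|split]; auto; exists t; auto. }
            intros [H|[H|(s' & Hs' & H)]]; auto.
            now rewrite (chosen_fun J s s').
          - intros H; right; right; eauto. }
        destruct (chosen_undecided J s Hs) as (Hss & Hsw & _ & Hsc).
        split.
        -- intros t Ht; apply E in Ht as (? & ? & _); auto.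
        -- intros t t' Ht Ht' Htt; apply E in Ht as (_ & H1 & j & Hj & H2).
           apply E; split; [assumption|split; [intros y; auto|]].
           exists j; split; auto.
        -- intros t t' u Ht Ht' Hu Huy.
           apply E in Ht as (_ & H1 & j & Hj & H2).
           apply E in Ht' as (_ & H1' & j' & Hj' & H2').
           destruct (binary_union j j') as (k & Hk & Hky).
           apply E; split; [assumption|split].
           ++ intros y Hy; destruct (Huy y Hy); auto.
           ++ exists k; split.
              ** apply (ideal_cup _ _ HJ j j'); auto; intros y; apply Hky.
              ** intros y Hy; rewrite Hky.
                 destruct (Huy y Hy) as [Hyt|Hyt];
                 [destruct (H2 y Hyt)|destruct (H2' y Hyt)]; auto.
        (* A [j] in [J] that covers [w] together with [s] includes the complement [r] of [s]. Then
           [r] is in [J], although [s] is undecided. *)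
        -- intros Hwt; apply E in Hwt as (_ & _ & j & Hj & Hwj).
           destruct (separation (fun y => ~ mem y s) w) as (r & Hr & Hry); [define|].
           apply (Hsc r); [now split|].
           apply (ideal_down _ _ HJ j r); auto.
           intros y Hy; apply Hry in Hy as [Hy1 Hy2].
           destruct (Hwj y Hy1); tauto.
      (* With nothing to adjoin, the step leaves [J] unchanged, since [J] already includes [I]. *)
      * replace J' with J; [assumption|].
        apply set_ext; [now apply (set_of_mem J s0), HIJ|assumption|].
        intros z; rewrite HJn; split; [intros H; right; auto|].
        intros [H|[H|(s & H & _)]]; auto; destruct N; eauto.
  - intros C u HC Hch [Hu Huz].
    (* Either all members of [C] are empty, and so is the union, or the nonempty ones are proper
       ideals including [I]. *)
    destruct (classic (exists J, mem J C /\ exists z, mem z J))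
      as [(J0 & HJ0 & z0 & Hz0)|N].
    2:{ left; intros z Hz; apply Huz in Hz as (J & HJ & Hz); eauto. }
    right.
    assert (HC' : forall J s, mem J C -> mem s J ->
      is_proper_ideal w J /\ subset U I J).
    { intros J s HJ Hs; destruct (HC J HJ) as [H|H]; [now destruct (H s)|assumption]. }
    split; [split|].
    + intros s Hs; apply Huz in Hs as (J & HJ & Hs).
      now apply (ideal_part w J); [apply (HC' J s)|].
    + intros s t Hs Ht Hts; apply Huz in Hs as (J & HJ & Hs).
      apply Huz; exists J; split; [assumption|].
      apply (ideal_down w J) with s; auto; now apply (HC' J s).
    + intros s t v Hs Ht Hv Hvy.
      apply Huz in Hs as (J & HJ & Hs); apply Huz in Ht as (K & HK & Ht).
      (* By the chain condition, one of [J] and [K] contains both [s] and [t]. *)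
      apply Huz; destruct (Hch J K HJ HK) as [H|H]; [exists K|exists J];
      (split; [assumption|]).
      * apply (ideal_cup w K) with s t; auto; now apply (HC' K t).
      * apply (ideal_cup w J) with s t; auto; now apply (HC' J s).
    + intros Hwu; apply Huz in Hwu as (J & HJ & Hs).
      now apply (ideal_proper w J); [apply (HC' J w)|].
    + intros z Hz; apply Huz; exists J0; split; [assumption|].
      now apply (HC' J0 z0).
  - assert (HIM : subset U I M) by (intros z Hz; apply HMn; left; assumption).
    destruct PM as [PM|[PM _]]; [now destruct (PM s0); apply HIM|].
    exists M; split; [assumption|split; [assumption|]].
    (* If neither set were in [M], then [s] would be undecided. Some undecided [a] would be chosen
       and adjoined, hence already be in the fixed point [M]. *)
    intros s t Hs Hsw Ht; apply NNPP; intros N.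
    destruct (separation (undecided M) PW) as (B & HB & HBr).
    { unfold undecided, complement; define. }
    assert (E : forall r, mem r B <-> undecided M r).
    { intros r; rewrite HBr; split; [tauto|]; intros H; split; [|assumption].
      apply HPW; split; apply H. }
    destruct (c_tot B) as [a Ha]; [assumption|intros r Hr; now apply HBr| |].
    { exists s; apply E; split; [|split; [|split]]; auto.
      intros r Hr Hr'; apply N; right; replace t with r; [assumption|].
      apply set_ext; [apply Hr|apply Ht|]; intros y.
      now rewrite (proj2 Hr), (proj2 Ht). }
    assert (Hca : chosen M a) by (exists B; auto).
    destruct (chosen_undecided M a Hca) as (H1 & H2 & H3 & _).
    apply H3, HMn; right; right; exists a; split; [assumption|].
    split; [assumption|split; [assumption|]].
    (* [s0] only supplies a member of [M]; [a] is covered by [a] itself. *)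
    exists s0; split; auto.
Qed.

(** * From the Łoś theorem to Collection *)

Lemma collection_of_Los :
  Los_holds_for_all_internal_ultrapowers U -> Collection U.
Proof.
  intros HL phi e w Hw.
  set (R y a := sat U (scons y (scons a e)) phi) in *.
  assert (dR : definable (fun e => R (e 0) (e 1))) by apply definable_sat2.
  (* An urelement has no members, so Collection on it is trivial; the base of an ultrafilter has to
     be a set. *)
  destruct (classic (is_set U w)) as [Ws|Wu].
  2:{ exists w; intros y Hy; destruct Wu; now apply set_of_mem with y. }
  apply NNPP; intros N.
  destruct (powerset w) as (PW & _ & HPW).
  set (bounded s := exists v, forall y, mem y s -> exists a, mem a v /\ R y a).
  assert (dbounded : definable (fun e => bounded (e 0))) by (unfold bounded; define).
  destruct (separation bounded PW dbounded) as (I & _ & HI).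
  (* The empty set makes [I] nonempty, as [prime_ideal] demands. *)
  destruct (separation (fun _ => False) w) as (o & Ho & Hoy).
  { apply definable_iff with (fun e => ~ e 0 = e 0); [define|]; tauto. }
  assert (small : forall s, is_set U s -> (forall y, ~ mem y s) -> mem s I).
  { intros s Hs Hsy; apply HI; split.
    - apply HPW; split; [assumption|intros y Hy; now destruct (Hsy y)].
    - exists w; intros y Hy; now destruct (Hsy y). }
  destruct (prime_ideal w I Ws) as (M & HM & HIM & Hprime).
  - split.
    + intros s Hs; exact (proj1 (HPW s) (proj1 (proj1 (HI s) Hs))).
    + intros s t Hs Ht Hts; apply HI in Hs as [Hs [v Hv]]; apply HI; split.
      * apply HPW in Hs as [_ Hs]; apply HPW; split; [|intros y]; auto.
      * exists v; auto.
    + intros s t u Hs Ht Hu Huy.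
      apply HI in Hs as [Hs [v Hv]]; apply HI in Ht as [Ht [v' Hv']].
      apply HPW in Hs as [_ Hs]; apply HPW in Ht as [_ Ht].
      apply HI; split.
      * apply HPW; split; [assumption|intros y Hy; destruct (Huy y Hy); auto].
      * destruct (binary_union v v') as (k & _ & Hk).
        exists k; intros y Hy; destruct (Huy y Hy) as [H|H];
        [destruct (Hv y H) as (a & ? & ?)|destruct (Hv' y H) as (a & ? & ?)];
        exists a; rewrite Hk; auto.
    + intros H; now apply N, HI.
  - exists o; apply small; [assumption|intros y Hy; now apply Hoy in Hy].
  (* The filter dual to [M]: as [M] is prime, the subsets of [w] outside [M] are the complements of
     its members. *)
  - destruct (separation (fun s => ~ mem s M) PW) as (F & Fs & HF); [define|].
    assert (HFp : forall s, mem s F -> is_set U s /\ subset U s w).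
    { intros s Hs; exact (proj1 (HPW s) (proj1 (proj1 (HF s) Hs))). }
    assert (HFi : forall s, is_set U s -> subset U s w -> ~ mem s M -> mem s F).
    { intros s H1 H2 H3; apply HF; split; [now apply HPW|assumption]. }
    assert (cover : forall s t, mem s M -> mem t M ->
      ~ forall y, mem y w -> mem y s \/ mem y t).
    { intros s t Hs Ht H; apply (ideal_proper w M HM).
      now apply (ideal_cup w M HM s t). }
    assert (UF : is_ultrafilter_on U F w).
    { split; auto.
      - apply HFi; [assumption|intros y; auto|apply (ideal_proper w M HM)].
      - intros s Hs; apply NNPP; intros H.
        apply HF in Hs as [Hs Hs']; apply Hs', HIM, small; [now apply HPW|].
        intros y Hy; apply H; eauto.
      - intros s t Hs Ht Hst Htw; apply HFi; auto; intros H.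
        destruct (HFp s Hs) as [Hss _].
        apply HF in Hs as [_ Hs]; apply Hs, (ideal_down w M HM t); auto.
      - intros s t u Hs Ht Hu Huy.
        destruct (HFp s Hs) as [Hss Hsw], (HFp t Ht) as [Hts Htw].
        apply HFi; auto; [intros y Hy; apply Hsw; now apply Huy|].
        intros HuM.
        destruct (separation (fun y => ~ mem y s) w) as (s' & Hs'); [define|].
        destruct (separation (fun y => ~ mem y t) w) as (t' & Ht'); [define|].
        apply HF in Hs as [_ Hs]; apply HF in Ht as [_ Ht].
        (* The complements of [s] and [t] lie in [M], and their union [k] covers [w] together with
           the intersection [u]. *)
        destruct (Hprime s s') as [?|Hs'M]; auto.
        destruct (Hprime t t') as [?|Ht'M]; auto.
        destruct (binary_union s' t') as (k & Hk & Hky).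
        assert (HkM : mem k M).
        { apply (ideal_cup w M HM s' t'); auto; intros y; apply Hky. }
        apply (cover u k); auto; intros y Hy.
        rewrite Hky, Huy, (proj2 Hs'), (proj2 Ht'); tauto.
      - intros s t Hs Hsw Ht Hty.
        destruct (classic (mem s M)) as [HsM|HsM]; [|auto].
        right; apply HFi; [assumption|intros y Hy; now apply Hty|].
        intros HtM; apply (cover s t); auto; intros y Hy.
        rewrite Hty; destruct (classic (mem y s)); auto. }
    (* The variable [y] is represented by the identity function, each parameter [e n] by a constant
       function. *)
    destruct (function_of_relation (fun y b => b = y) w) as (i & Hi & Hia).
    { define. }
    { intros y _; exists y; split; auto. }
    assert (HK : forall n, exists k, is_fun_on U k w /\
      forall y b, mem y w -> (app U k y b <-> b = e n)).
    { intros n; apply (function_of_relation (fun y b => b = e n) w); [define|].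
      intros y _; exists (e n); split; auto. }
    (* Representatives are needed for all indices at once, so the constant functions are chosen
       simultaneously in the metatheory. *)
    set (k n := proj1_sig (constructive_indefinite_description _ (HK n))).
    assert (Hk : forall n, is_fun_on U (k n) w /\
      forall y b, mem y w -> (app U (k n) y b <-> b = e n)).
    { intros n; exact (proj2_sig (constructive_indefinite_description _ (HK n))). }
    (* [R] reads [y] at index 0 and the witness at index 1, whereas [Ex] binds index 0. *)
    set (swap n := match n with 0 => 1 | 1 => 0 | _ => n end).
    assert (Hswap : forall y a,
      sat U (scons a (scons y e)) (rename swap phi) <-> R y a).
    { intros y a; rewrite sat_rename.
      replace (fun n => scons a (scons y e) (swap n)) with (scons y (scons a e));
        [reflexivity|].
      apply functional_extensionality; now intros [|[|n]]. }
    assert (hf : forall n, is_fun_on U (scons i k n) w).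
    { intros [|n]; [assumption|apply Hk]. }
    assert (Hdiag : forall y, mem y w -> forall n,
      app U (scons i k n) y (scons y e n)).
    { intros y Hy [|n]; [now apply Hia|now apply Hk]. }
    assert (Hex : sat (ultrapower U F w)
      (fun n => cls U F w (scons i k n) (hf n)) (Ex (rename swap phi))).
    { apply (HL F w UF); exists w; split; [assumption|split; [|apply UF]].
      intros y; split; [|tauto]; intros Hy; split; [assumption|].
      exists (scons y e); split; [now apply Hdiag|].
      destruct (Hw y Hy) as [a Ha]; exists a; now apply Hswap. }
    cbn [sat] in Hex; destruct Hex as [[c' [g [hg ->]]] Hc].
    set (hf' n := match n return is_fun_on U (scons g (scons i k) n) w with
                  | 0 => hg | S m => hf m end).
    (* Łoś once more, now for the matrix: [R] relates [y] to the value of [g] at [y] for all [y] in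
       a set [s] of [F]. *)
    destruct (proj1 (HL F w UF (rename swap phi) (scons g (scons i k)) hf'))
      as (s & _ & Hsy & HsF).
    { match type of Hc with sat _ ?a _ => match goal with |- sat _ ?b _ =>
        replace b with a; [assumption|] end end.
      apply functional_extensionality; now intros [|n]. }
    (* Replacement bounds the range of [g]. Hence [s] is bounded and lies in [M], against [s] being
       in [F]. *)
    destruct (replacement (app U g) w) as [v Hv]; [define|apply hg|].
    apply HF in HsF as [HsP HsM]; apply HsM, HIM, HI; split; [assumption|].
    exists v; intros y Hy; apply Hsy in Hy as [Hy (e' & He' & Hs)].
    destruct (Hv y Hy) as (a & Ha & Hga).
    exists a; split; [assumption|]; apply Hswap.
    (* Functions are single-valued, so the assignment supplied by Łoś is the expected one. *)
    replace (scons a (scons y e)) with e'; [assumption|].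
    apply functional_extensionality; intros [|n].
    + exact (app_fun _ _ _ _ _ hg (He' 0) Hga).
    + exact (app_fun _ _ _ _ _ (hf n) (He' (S n)) (Hdiag y Hy n)).
Qed.

(** * Function values as definable terms *)

(* [f] is a junk value, taken where [f] is not single-valued at [y]. *)
Definition is_value (f y b : U) : Prop :=
  ((exists! c, app U f y c) /\ app U f y b) \/
  (~ (exists! c, app U f y c) /\ b = f).

(** Application as a total Rocq function, usable in terms and assignments. As [is_value] also
    settles the junk case, the graph is definable everywhere. *)
Definition value (f y : U) : U := epsilon (inhabits f) (is_value f y).

Lemma value_spec (f y b : U) : b = value f y <-> is_value f y b.
Proof.
  assert (E : is_value f y (value f y)).
  { unfold value; apply epsilon_spec; destruct (classic (exists! c, app U f y c)) as [H|H].
    - destruct H as (c & Hc & Hu); exists c; left; split; [now exists c|assumption].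
    - exists f; right; auto. }
  split; [now intros ->|].
  destruct E as [[(c & Hc & Hu) H]|[H ->]]; intros [[Hex Hb]|[Hn ->]];
    try tauto.
  - now rewrite <- (Hu _ Hb), <- (Hu _ H).
  - destruct Hn; now exists c.
Qed.

Lemma app_value (f x y b : U) : is_fun_on U f x -> mem y x ->
  (app U f y b <-> b = value f y).
Proof.
  intros Hf Hy; rewrite value_spec; unfold is_value.
  pose proof (proj2 (proj2 Hf) y Hy); tauto.
Qed.

Lemma definable_term_value (f : U) (t : (nat -> U) -> U) :
  definable_term t -> definable_term (fun e => value f (t e)).
Proof.
  intros Ht.
  apply (definable_subst _ (fun a e => e 0 = value f a)
           (fun e => t (fun n => e (S n)))); [|now apply definable_term_lift].
  apply definable_iff with (fun e => is_value f (e 0) (e 1)).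
  - unfold is_value; define.
  - intros e; symmetry; apply value_spec.
Qed.

(** Induction on [phi] with a term for every variable; under a quantifier the terms are lifted and
    index 0 becomes the term for the bound variable. *)
Lemma definable_sat (phi : formula) (t : nat -> (nat -> U) -> U) :
  (forall n, definable_term (t n)) ->
  definable (fun e => sat U (fun n => t n e) phi).
Proof.
  revert t; induction phi as [| | |phi IH|phi IH psi IH'|phi IH];
    intros t Ht; cbn.
  - now apply definable_eq.
  - now apply definable_mem.
  - now apply definable_ur.
  - now apply definable_neg, IH.
  - now apply definable_and; [apply IH|apply IH'].
  - apply definable_ex.
    apply definable_iff with (fun e => sat U (fun n =>
      scons (fun e => e 0) (fun m e => t m (fun k => e (S k))) n e) phi).
    + apply IH; intros [|n]; cbn; [define_term|apply definable_term_lift, Ht].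
    + intros e; match goal with |- sat _ ?a _ <-> sat _ ?b _ =>
        replace a with b; [tauto|] end.
      apply functional_extensionality; now intros [|n].
Qed.

(** * From Collection to the Łoś theorem *)

Section Ultrapower.
Variables F x : U.
Hypothesis hF : is_ultrafilter_on U F x.

Lemma large_iff (P Q : U -> Prop) : (forall y, mem y x -> (P y <-> Q y)) ->
  (large U F x P <-> large U F x Q).
Proof.
  intros H; unfold large; split; intros (s & Hs & Hy & HsF); exists s;
    (split; [assumption|split; [|assumption]]);
    intros y; rewrite Hy; split; intros [? ?]; split; try apply H; auto.
Qed.

(** Largeness asserts that the truth set of [Q] exists in [U]; definability of [Q] provides it by
    Separation, and it includes [s]. *)
Lemma large_of_mem (s : U) (Q : U -> Prop) :
  definable (fun e => Q (e 0)) -> mem s F -> (forall y, mem y s -> Q y) ->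
  large U F x Q.
Proof.
  intros dQ Hs HQ; destruct (separation Q x dQ) as (t & Ht & Hty).
  exists t; split; [assumption|split; [assumption|]].
  destruct (uf_subsets _ _ _ hF s Hs) as [_ Hsx].
  apply (uf_up _ _ _ hF s t); auto; intros y Hy; apply Hty; auto.
Qed.

Lemma large_mono (P Q : U -> Prop) : definable (fun e => Q (e 0)) ->
  large U F x P -> (forall y, mem y x -> P y -> Q y) -> large U F x Q.
Proof.
  intros dQ (s & Hs & Hy & HsF) H; apply large_of_mem with s; auto.
  intros y Hys; now apply H; apply Hy.
Qed.

Lemma large_and (P Q : U -> Prop) :
  definable (fun e => P (e 0)) -> definable (fun e => Q (e 0)) ->
  (large U F x (fun y => P y /\ Q y) <-> large U F x P /\ large U F x Q).
Proof.
  intros dP dQ; split.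
  - intros H; split; (eapply large_mono; [assumption|exact H|]); cbn; tauto.
  - intros [(s & _ & Hsy & HsF) (t & _ & Hty & HtF)].
    destruct (separation (fun y => mem y t) s) as (u & Hu & Huy); [define|].
    apply large_of_mem with u.
    + now apply definable_and.
    + now apply (uf_inter _ _ _ hF s t).
    + intros y Hy; apply Huy in Hy as [H1 H2].
      split; [now apply Hsy|now apply Hty].
Qed.

Lemma large_neg (P : U -> Prop) : definable (fun e => P (e 0)) ->
  (large U F x (fun y => ~ P y) <-> ~ large U F x P).
Proof.
  intros dP; split.
  - intros HN HP.
    destruct (proj2 (large_and P (fun y => ~ P y) dP (definable_neg _ _ dP)))
      as (s & _ & Hsy & HsF); [now split|].
    destruct (uf_nonempty _ _ _ hF s HsF) as [y Hy].
    apply Hsy in Hy; tauto.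
  - intros HP; destruct (separation P x dP) as (s & Hs & Hsy).
    destruct (separation (fun y => ~ mem y s) x) as (t & Ht & Hty); [define|].
    destruct (uf_ultra _ _ _ hF s t) as [H|H]; auto.
    + intros y Hy; now apply Hsy.
    + destruct HP; exists s; auto.
    + apply large_of_mem with t; [now apply definable_neg|assumption|].
      intros y Hy; apply Hty in Hy; rewrite Hsy in Hy; tauto.
Qed.

Lemma definable_value_eq (f g : U) :
  definable (fun e => value f (e 0) = value g (e 0)).
Proof. apply definable_eq; apply definable_term_value; define_term. Qed.

Lemma eqF_iff (f g : U) : is_fun_on U f x -> is_fun_on U g x ->
  (eqF U F x f g <-> large U F x (fun y => value f y = value g y)).
Proof.
  intros hf hg; apply large_iff; intros y Hy; split.
  - intros (a & Ha & Hb).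
    apply (app_value f x) in Ha; apply (app_value g x) in Hb; auto; congruence.
  - intros E; exists (value f y); split; [now apply (app_value f x)|].
    now apply (app_value g x).
Qed.

Lemma cls_eq_iff (f g : U) (hf : is_fun_on U f x) (hg : is_fun_on U g x) :
  cls U F x f hf = cls U F x g hg <->
  large U F x (fun y => value f y = value g y).
Proof.
  rewrite <- eqF_iff by assumption; split.
  - intros E; apply (f_equal (@proj1_sig _ _)) in E; cbn in E.
    (* [g] lies in its own class, hence in the equal class of [f]. *)
    assert (K : eqF_class U F x g g).
    { split; [assumption|]; apply eqF_iff; auto.
      apply large_of_mem with x; [apply definable_value_eq|apply hF|auto]. }
    rewrite <- E in K; apply K.
  (* Classes are predicates, so their equality reduces to symmetry and transitivity of agreement on
     a large set. *)
  - intros E; apply eq_sig_hprop; [intros; apply proof_irrelevance|]; cbn.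
    apply functional_extensionality; intros h; apply propositional_extensionality.
    unfold eqF_class; split; intros [Hh K]; (split; [assumption|]);
    apply eqF_iff in E; apply eqF_iff in K; auto; apply eqF_iff; auto;
    pose proof (proj2 (large_and _ _ (definable_value_eq _ _)
      (definable_value_eq _ _)) (conj E K)) as H;
    (eapply large_mono; [apply definable_value_eq|exact H|]); cbn;
    intros y _ [? ?]; congruence.
Qed.

Lemma cls_surjective (c : ultrapower U F x) : exists f hf, c = cls U F x f hf.
Proof. destruct c as [c [f [hf ->]]]; now exists f, hf. Qed.

(** Membership in the ultrapower is witnessed by some representatives; they agree with the given
    ones on a large set, and intersecting transfers the relation. *)
Lemma mem_cls_iff (f g : U) (hf : is_fun_on U f x) (hg : is_fun_on U g x) :
  @mem (ultrapower U F x) (cls U F x g hg) (cls U F x f hf) <->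
  large U F x (fun y => mem (value g y) (value f y)).
Proof.
  assert (E : forall f' g', is_fun_on U f' x -> is_fun_on U g' x ->
    (large U F x (fun y => exists a b, app U g' y a /\ app U f' y b /\ mem a b) <->
     large U F x (fun y => mem (value g' y) (value f' y)))).
  { intros f' g' hf' hg'; apply large_iff; intros y Hy; split.
    - intros (a & b & Ha & Hb & H).
      apply (app_value g' x) in Ha; apply (app_value f' x) in Hb; auto; congruence.
    - intros H; exists (value g' y), (value f' y).
      split; [now apply (app_value g' x)|].
      split; [now apply (app_value f' x)|assumption]. }
  cbn; split.
  - intros (g' & f' & hg' & hf' & Eg & Ef & H); apply E in H; auto.
    apply cls_eq_iff in Eg; apply cls_eq_iff in Ef.
    pose proof (proj2 (large_and _ _ (definable_value_eq _ _)
      (definable_value_eq _ _)) (conj Eg Ef)) as H'.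
    assert (dm : forall f g, definable (fun e => mem (value g (e 0)) (value f (e 0)))).
    { intros; apply definable_mem; apply definable_term_value; define_term. }
    pose proof (proj2 (large_and _ _ (definable_and _ _ _ (definable_value_eq _ _)
      (definable_value_eq _ _)) (dm f' g')) (conj H' H)) as K.
    eapply large_mono; [apply dm|exact K|]; cbn.
    intros y _ [[-> ->] ?]; assumption.
  - intros H; exists g, f, hg, hf; split; [reflexivity|split; [reflexivity|]].
    now apply E.
Qed.

Lemma ur_cls_iff (f : U) (hf : is_fun_on U f x) :
  @ur (ultrapower U F x) (cls U F x f hf) <->
  large U F x (fun y => ur (value f y)).
Proof.
  assert (E : forall f', is_fun_on U f' x ->
    (large U F x (fun y => exists a, app U f' y a /\ ur a) <->
     large U F x (fun y => ur (value f' y)))).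
  { intros f' hf'; apply large_iff; intros y Hy; split.
    - intros (a & Ha & H); apply (app_value f' x) in Ha; auto; congruence.
    - intros H; exists (value f' y); split; [now apply (app_value f' x)|assumption]. }
  cbn; split.
  - intros (f' & hf' & Ef & H); apply E in H; auto.
    apply cls_eq_iff in Ef.
    assert (du : forall f, definable (fun e => ur (value f (e 0)))).
    { intros; apply definable_ur, definable_term_value; define_term. }
    pose proof (proj2 (large_and _ _ (definable_value_eq _ _)
      (du f')) (conj Ef H)) as K.
    eapply large_mono; [apply du|exact K|]; cbn.
    intros y _ [-> ?]; assumption.
  - intros H; exists f, hf; split; [reflexivity|]; now apply E.
Qed.

Lemma definable_sat_values (phi : formula) (f : nat -> U) :
  definable (fun e => sat U (fun n => value (f n) (e 0)) phi).
Proof.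
  apply (definable_sat phi (fun n e => value (f n) (e 0))).
  intros n; apply definable_term_value; define_term.
Qed.

(** The one place where Collection enters: [v] bounds witnesses on [s], and a choice function on the
    subsets of [v] selects one from the witnesses in [v]. *)
Lemma function_of_large_ex (hC : Collection U) (R : U -> U -> Prop) :
  definable (fun e => R (e 0) (e 1)) ->
  large U F x (fun y => exists a, R y a) ->
  exists g, is_fun_on U g x /\ large U F x (fun y => R y (value g y)).
Proof.
  intros dR (s & Hs & Hsy & HsF).
  destruct (collection hC R s dR) as [v Hv]; [intros y Hy; now apply Hsy|].
  destruct (choice_on_subsets v) as (c & c_fun & c_mem & c_tot).
  set (values y B := is_set U B /\ forall a, mem a B <-> mem a v /\ R y a).
  (* Where [v] contains no witness, which never happens on [s], the function takes the default value
     [x]. *)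
  destruct (function_of_relation (fun y b =>
    (exists B, values y B /\ app U c B b) \/
    (~ (exists a, mem a v /\ R y a) /\ b = x)) x) as (g & hg & Hg).
  - unfold values; define.
  - intros y Hy; destruct (classic (exists a, mem a v /\ R y a)) as [E|E].
    + destruct (separation (R y) v) as (B & HB & HBa); [define|].
      destruct (c_tot B) as [b Hb]; auto.
      { intros a Ha; now apply HBa. }
      { destruct E as [a Ha]; exists a; now apply HBa. }
      exists b; split; [left; exists B; split; [split|]; auto|].
      intros b' [(B' & [HB' HBa'] & Hb')|[? _]]; [|tauto].
      apply c_fun with B; [assumption|].
      replace B with B'; [assumption|].
      apply set_ext; auto; intros z; now rewrite HBa, HBa'.
    + exists x; split; [auto|].
      intros b [(B & [_ HBa] & Hb)|[_ ->]]; [|reflexivity].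
      destruct E; exists b; now apply HBa, c_mem.
  - exists g; split; [assumption|].
    apply large_of_mem with s; [|assumption|].
    + apply (definable_app2 _ R (fun e => e 0) (fun e => value g (e 0)));
        [assumption| |apply definable_term_value]; define_term.
    + intros y Hy; assert (Hyx : mem y x) by now apply Hsy.
      destruct (proj1 (Hg y _ Hyx) (proj2 (app_value g x y _ hg Hyx) eq_refl))
        as [(B & [_ HBa] & Hb)|[N _]].
      * now apply HBa, c_mem.
      * destruct N, (Hv y Hy) as (a & Ha); eauto.
Qed.

(** Induction on [phi]. Negation rests on the ultrafilter property, and the right-to-left
    existential case on a function of witnesses. *)
Lemma Los_value (hC : Collection U) (phi : formula) (f : nat -> U)
  (hf : forall n, is_fun_on U (f n) x) :
  sat (ultrapower U F x) (fun n => cls U F x (f n) (hf n)) phi <->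
  large U F x (fun y => sat U (fun n => value (f n) y) phi).
Proof.
  revert f hf; induction phi as [i j|i j|i|phi IH|phi IH psi IH'|phi IH];
    intros f hf.
  - apply cls_eq_iff.
  - apply mem_cls_iff.
  - apply ur_cls_iff.
  - cbn [sat]; rewrite IH; symmetry; apply large_neg, definable_sat_values.
  - cbn [sat]; rewrite IH, IH'; symmetry.
    apply large_and; apply definable_sat_values.
  (* The induction hypothesis, read for the representatives extended by [g]. *)
  - assert (Hsc : forall g hg,
      sat (ultrapower U F x)
        (scons (cls U F x g hg) (fun n => cls U F x (f n) (hf n))) phi <->
      large U F x (fun y => sat U (scons (value g y) (fun n => value (f n) y)) phi)).
    { intros g hg.
      set (hf' n := match n return is_fun_on U (scons g f n) x with
                    | 0 => hg | S m => hf m end).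
      specialize (IH (scons g f) hf').
      replace (scons (cls U F x g hg) (fun n => cls U F x (f n) (hf n)))
        with (fun n => cls U F x (scons g f n) (hf' n))
        by (apply functional_extensionality; now intros [|n]).
      rewrite IH; apply large_iff; intros y _.
      replace (fun n => value (scons g f n) y)
        with (scons (value g y) (fun n => value (f n) y))
        by (apply functional_extensionality; now intros [|n]).
      reflexivity. }
    cbn [sat]; split.
    + intros [c Hc]; destruct (cls_surjective c) as (g & hg & ->).
      apply Hsc in Hc.
      apply large_mono with (2 := Hc); [|intros y _ H; eauto].
      apply (definable_sat_values (Ex phi)).
    + intros H.
      destruct (function_of_large_ex hC (fun y a =>
        sat U (scons a (fun n => value (f n) y)) phi)) as (g & hg & Hg); auto.
      * apply definable_iff with (fun e => sat U (fun n =>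
          scons (fun e => e 1) (fun m e => value (f m) (e 0)) n e) phi).
        -- apply definable_sat; intros [|n]; cbn;
           [|apply definable_term_value]; define_term.
        -- intros e.
           replace (scons (e 1) (fun n => value (f n) (e 0)))
             with (fun n => scons (fun e => e 1)
                     (fun m e => value (f m) (e 0)) n e)
             by (apply functional_extensionality; now intros [|n]).
           reflexivity.
      * exists (cls U F x g hg); now apply Hsc.
Qed.

(** At each [y] in [x] the assignment quantified in [Los_theorem_holds] is forced to be the sequence
    of values, so [Los_value] applies. *)
Lemma Los_of_collection (hC : Collection U) : Los_theorem_holds U F x.
Proof.
  intros phi f hf; rewrite Los_value by assumption.
  apply large_iff; intros y Hy; split.
  - intros H; exists (fun n => value (f n) y); split; [|assumption].
    intros n; now apply (app_value (f n) x).
  - intros (e & He & Hs).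
    replace (fun n => value (f n) y) with e; [assumption|].
    apply functional_extensionality; intros n.
    now apply (app_value (f n) x).
Qed.

End Ultrapower.
End Sets.

Theorem theorem2p19 (U : structure) (hU : ZFCU_R U) :
  Los_holds_for_all_internal_ultrapowers U <-> Collection U.
Proof.
  split.
  - now apply collection_of_Los.
  - intros hC F x hF; now apply Los_of_collection.
Qed.
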